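(* Every stringent hypergroup is (isomorphic to) a wedge sum $\bigvee_{g\in G}F_g$, for some totally ordered set $(G,<)$ and some family $(F_g\mid g\in G)$ of hypergroups, where each $F_g$ is either a copy of the Krasner hypergroup, or a copy of the sign hypergroup, or a group.
   Context: A hyperoperation on a set $S$ is a map $\boxplus$ from $S\times S$ to the nonempty subsets of $S$; for nonempty $A,B\subseteq S$ put $A\boxplus B=\bigcup_{a\in A,b\in B}a\boxplus b$; $\boxplus$ is associative if $a\boxplus(b\boxplus c)=(a\boxplus b)\boxplus c$ for all $a,b,c$. A hypergroup is $(G,\boxplus,0)$ with $\boxplus$ an associative hyperoperation such that: $0\boxplus x=x\boxplus 0=\{x\}$ for all $x$; for every $x$ there is a unique $x'$ with $0\in x\boxplus x'$ and a unique $x''$ with $0\in x''\boxplus x$, and $x'=x''$, denoted $-x$; and $x\in y\boxplus z$ if and only if $-x\in -z\boxplus -y$. (Hypergroups need not be commutative.) A hypergroup is stringent if $a\boxplus b$ is a singleton whenever $a\neq-b$. A group (not necessarily commutative) is regarded as a hypergroup with single-valued hyperoperation. The Krasner hypergroup is $\{0,1\}$ with $0$ the identity and $1\boxplus1=\{0,1\}$. The sign hypergroup is $\{0,1,-1\}$ with $0$ the identity, $x\boxplus x=\{x\}$ and $1\boxplus-1=-1\boxplus1=\{0,1,-1\}$. Wedge sum: let $(G,<)$ be a totally ordered set, and $(F_g\mid g\in G)$ a family of hypergroups with a common identity $0$ but otherwise disjoint (replace them by isomorphic copies if necessary), with hyperaddition $\boxplus_g$ on $F_g$. Let $F_g^\times=F_g\setminus\{0\}$,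 and let $\psi:\bigcup_{g}F_g^\times\to G$ send $f\in F_g^\times$ to $g$; $\psi$ is required to be surjective (i.e. each $F_g\ne\{0\}$). Write $g\downarrow=\{h\in G\mid h<g\}$. The wedge sum $\bigvee_{g\in G}F_g$ has ground set $\{0\}\cup\bigcup_{g\in G}F_g$ and hyperaddition $x\boxplus0=0\boxplus x=\{x\}$ and, for nonzero $x,y$: $x\boxplus y=\{x\}$ if $\psi(x)>\psi(y)$; $=\{y\}$ if $\psi(x)<\psi(y)$; $=x\boxplus_{\psi(x)}y$ if $\psi(x)=\psi(y)$ and $0\notin x\boxplus_{\psi(x)}y$; $=(x\boxplus_{\psi(x)}y)\cup\psi^{-1}(\psi(x)\downarrow)$ if $\psi(x)=\psi(y)$ and $0\in x\boxplus_{\psi(x)}y$. *)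

(* Defs.v *)
From HB Require Import structures.
From mathcomp Require Import all_boot all_order.
From mathcomp Require Import boolp classical_sets.
Set Implicit Arguments.
Unset Strict Implicit.
Unset Printing Implicit Defensive.

Local Open Scope classical_set_scope.

Record hyperStructure := HyperStructure {
  hsort :> Type;
  hzero : hsort;
  hadd : hsort -> hsort -> set hsort;
  hadd_nonempty : forall x y, hadd x y !=set0
}.

Arguments hzero : clear implicits.
Arguments hadd {_} _ _.

Definition haddS (G : hyperStructure) (A B : set G) : set G :=
  \bigcup_(a in A) \bigcup_(b in B) hadd a b.

Record hypergroup := Hypergroup {
  hypergroup_struct :> hyperStructure;
  hopp : hypergroup_struct -> hypergroup_struct;
  haddA : forall a b c : hypergroup_struct,
    haddS [set a] (hadd b c) = haddS (hadd a b) [set c];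
  hadd0l : forall x : hypergroup_struct, hadd (hzero _) x = [set x];
  hadd0r : forall x : hypergroup_struct, hadd x (hzero _) = [set x];
  hoppr_unique : forall x : hypergroup_struct,
    unique [set y | hadd x y (hzero _)] (hopp x);
  hoppl_unique : forall x : hypergroup_struct,
    unique [set y | hadd y x (hzero _)] (hopp x);
  hadd_reversible : forall x y z : hypergroup_struct,
    hadd y z x <-> hadd (hopp z) (hopp y) (hopp x)
}.

Arguments hopp {_} _.

Definition stringent (G : hypergroup) : Prop :=
  forall a b : G, a <> hopp b -> exists c, hadd a b = [set c].

Definition hiso (G H : hyperStructure) : Prop :=
  exists f : G -> H, [/\ bijective f, f (hzero G) = hzero H &
    forall x y, f @` hadd x y = hadd (f x) (f y)].

(* The Krasner hypergroup, with 0 and 1 encoded as false and true. *)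
Definition krasner_add (x y : bool) : set bool :=
  if x && y then setT else [set x || y].

Lemma krasner_add_nonempty x y : krasner_add x y !=set0.
Proof. by exists (x || y); case: x y => [] []. Qed.

Definition krasner : hyperStructure :=
  HyperStructure false krasner_add_nonempty.

Variant sign : Type := Zero | Plus | Minus.

Definition sign_add (x y : sign) : set sign :=
  match x, y with
  | Zero, _ => [set y]
  | _, Zero => [set x]
  | Plus, Plus => [set Plus]
  | Minus, Minus => [set Minus]
  | _, _ => setT
  end.

Lemma sign_add_nonempty x y : sign_add x y !=set0.
Proof. by case: x y => [] []; (exists Zero + exists Plus + exists Minus). Qed.

Definition sign_hypergroup : hyperStructure :=
  HyperStructure Zero sign_add_nonempty.

Definition group_add (K : groupType) (x y : K) : set K := [set (x * y)%g].

Lemma group_add_nonempty (K : groupType) (x y : K) : group_add x y !=set0.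
Proof. by exists (x * y)%g. Qed.

Definition group_hyper (K : groupType) : hyperStructure :=
  HyperStructure 1%g (@group_add_nonempty K).

Section Wedge.
Variables (d : Order.disp_t) (G : orderType d) (F : G -> hypergroup).

Definition nonzero (g : G) : Type := {x : F g | x <> hzero (F g)}.

(* The disjoint union of the F_g minus their zeros, as tagged pairs. *)
Definition wedge_nonzero : Type := {g : G & nonzero g}.

Definition psi (x : wedge_nonzero) : G := tag x.

(* None is the common zero. *)
Definition wedge_sort : Type := option wedge_nonzero.

Definition wedge_in (g : G) (x : F g) : wedge_sort :=
  match pselect (x = hzero (F g)) with
  | left _ => None
  | right x_neq0 => Some (Tagged nonzero (exist _ x x_neq0))
  end.

Definition wedge_below (g : G) : set wedge_sort :=
  Some @` (psi @^-1` [set h | (h < g)%O]).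

(* x [+] y computed in F_(psi x); only meaningful when psi x = psi y, in which
   case tagged_as casts the component of y to F_(psi x). *)
Definition fiber_add (x y : wedge_nonzero) : set (F (psi x)) :=
  hadd (sval (tagged x)) (sval (tagged_as x y)).

Arguments fiber_add : clear implicits.

Definition wedge_add (u v : wedge_sort) : set wedge_sort :=
  match u, v with
  | None, _ => [set v]
  | _, None => [set u]
  | Some x, Some y =>
      if (psi y < psi x)%O then [set u]
      else if (psi x < psi y)%O then [set v]
      else if `[< fiber_add x y (hzero (F (psi x))) >] then
        (@wedge_in (psi x) @` fiber_add x y) `|` wedge_below (psi x)
      else @wedge_in (psi x) @` fiber_add x y
  end.

Lemma wedge_add_nonempty u v : wedge_add u v !=set0.
Proof.
case: u v => [x|] [y|] /=; try by eexists.
case: ifP => _; first by eexists.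
case: ifP => _; first by eexists.
have [z xyz] := hadd_nonempty (sval (tagged x)) (sval (tagged_as x y)).
have im : (@wedge_in (psi x) @` fiber_add x y) (wedge_in z) by exists z.
by case: ifP => _; exists (wedge_in z) => //; left.
Qed.

Definition wedge : hyperStructure := HyperStructure None wedge_add_nonempty.

End Wedge.

Arguments fiber_add {d G F} x y _.

(* Main.v *)
(* Call [x] below [y] when [x ∈ y ⊞ -y] and [x ≠ y, -y]; then [y] absorbs [x] on
   both sides, which rests on the identity [y ⊞ -y = -y ⊞ y]. This relation is a
   strict weak order, and addition of non-opposite incomparable elements stays
   within their incomparability class. A class of nonzero elements that contains
   some [x ∈ x ⊞ -x] can only be [{x, -x}], which together with [0] is the
   Krasner or the sign hypergroup; in any other class truncated addition is
   single-valued, that is, a group law. *)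
From HB Require Import structures.
Require Import Defs.
From mathcomp Require Import all_boot all_order.
From mathcomp Require Import boolp classical_sets.
Set Implicit Arguments.
Unset Strict Implicit.
Unset Printing Implicit Defensive.
Import Order.TTheory.
Local Open Scope classical_set_scope.

Local Notation "0" := (hzero _).
Local Notation "x ⊞ y" := (hadd x y) (at level 50, left associativity).
Local Notation "⊟ x" := (hopp x) (at level 35, right associativity).

(** * Opposites and the solving of sums in an arbitrary hypergroup *)

Section Hypergroup.
Variable H : hypergroup.
Implicit Types x y z t : H.

Lemma hadd_exA x y z t :
  (exists2 s, (y ⊞ z) s & (x ⊞ s) t) <-> (exists2 s, (x ⊞ y) s & (s ⊞ z) t).
Proof.
have [l r] : (haddS [set x] (y ⊞ z) t -> haddS (x ⊞ y) [set z] t) /\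
    (haddS (x ⊞ y) [set z] t -> haddS [set x] (y ⊞ z) t) by rewrite haddA.
split=> -[s ys xs].
  by have [|u xu [_ -> ut]] := l; [exists x => //; exists s | exists u].
by have [|_ -> [u yu ut]] := r; [exists s => //; exists z | exists u].
Qed.

Lemma haddxN x : (x ⊞ ⊟ x) 0.
Proof. by have [] := hoppr_unique x. Qed.

Lemma haddNx x : (⊟ x ⊞ x) 0.
Proof. by have [] := hoppl_unique x. Qed.

Lemma hadd_eq0r x y : (x ⊞ y) 0 -> ⊟ x = y.
Proof. by move=> xy0; have [_] := hoppr_unique x; apply. Qed.

Lemma hadd_eq0l x y : (x ⊞ y) 0 -> ⊟ y = x.
Proof. by move=> xy0; have [_] := hoppl_unique y; apply. Qed.

Lemma hoppK : involutive (@hopp H).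
Proof. by move=> x; apply/hadd_eq0r/haddNx. Qed.

Lemma hopp0 : ⊟ 0 = 0 :> H.
Proof. by apply/hadd_eq0r; rewrite hadd0l. Qed.

(** Regrouping [0 ∈ ⊟ x ⊞ (y ⊞ z)] yields [⊟ z ∈ ⊟ x ⊞ y], which reversibility turns round. *)
Lemma hadd_solver x y z : (y ⊞ z) x -> (⊟ y ⊞ x) z.
Proof.
move=> yzx.
have [|s xys sz] := (hadd_exA (⊟ x) y z 0).1.
  by exists x => //; apply: haddNx.
by apply/hadd_reversible; rewrite hoppK (hadd_eq0l sz).
Qed.

Lemma hadd_solvel x y z : (y ⊞ z) x -> (x ⊞ ⊟ z) y.
Proof.
move=> /hadd_reversible /hadd_solver; rewrite hoppK => /hadd_reversible.
by rewrite !hoppK.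
Qed.

End Hypergroup.

(** * The absorption order of a stringent hypergroup *)

Section Stringent.
Variables (H : hypergroup) (H_stringent : stringent H).
Implicit Types x y z t w : H.

Lemma hadd_set1 x y z : ⊟ x <> y -> (x ⊞ y) z -> x ⊞ y = [set z].
Proof.
move=> xNy; have [|c ->] := @H_stringent x y; last by move=> ->.
by move=> xE; apply: xNy; rewrite xE hoppK.
Qed.

Lemma haddxN_absorb x y : (x ⊞ ⊟ x) y -> (y ⊞ x) x.
Proof. by move=> /hadd_solvel; rewrite hoppK. Qed.

Lemma haddxN_opp x y : (x ⊞ ⊟ x) y -> (x ⊞ ⊟ x) (⊟ y).
Proof. by move=> /hadd_reversible; rewrite hoppK. Qed.

(* Suppose [x] lies in [y ⊞ ⊟ y] and put [z = y ⊞ x]. Associativity of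
   [y ⊞ x ⊞ y] gives [z ⊞ y = y ⊞ y], and this forces [z = y]. *)
Lemma haddxN_subNx y : y ⊞ ⊟ y `<=` ⊟ y ⊞ y.
Proof.
move=> x yNx.
have [yN|yN] := pselect (⊟ y = y); first by move: yNx; rewrite yN.
have xyy := haddxN_absorb yNx.
have [xN|xNNy] := pselect (⊟ x = y).
  move: yNx => /haddxN_opp; rewrite xN => /haddxN_absorb /hadd_solver.
  by move=> /hadd_reversible; rewrite hoppK -xN hoppK.
have xyE := hadd_set1 xNNy xyy.
have [z yxz] := hadd_nonempty y x.
have [zy|zNy] := pselect (z = y); first by apply: hadd_solver; rewrite -{2}zy.
have yxE : y ⊞ x = [set z].
  by apply: hadd_set1 => // yx; apply: xNNy; rewrite -yx hoppK.
have zy_sub : z ⊞ y `<=` y ⊞ y.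
  move=> t zyt; have [|s] := (hadd_exA y x y t).2; first by exists z.
  by rewrite xyE => ->.
have [w zyw] := hadd_nonempty z y.
(* Otherwise [w ⊞ ⊟ y] would be a singleton containing both [z] and [y]. *)
have wy : w = y.
  have [Nwy|Nwy] := pselect (⊟ w = ⊟ y); first exact: (inv_inj (@hoppK H)).
  have := hadd_solvel zyw; rewrite (@hadd_set1 w (⊟ y) y) //.
  exact/hadd_solvel/zy_sub.
have Nzy : ⊟ z <> y.
  move=> Nzy; apply: yN; apply: hadd_eq0r; apply: zy_sub.
  by rewrite -Nzy; apply: haddxN.
(* Since [y ∈ z ⊞ y], both [z] and [⊟ z] lie in [y ⊞ ⊟ y], so [⊟ y] absorbs [z]. Solving [z ∈ y ⊞ x]
   for [x] then gives the excluded [x = ⊟ y]. *)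
have yzE : ⊟ y ⊞ z = [set ⊟ y].
  apply: hadd_set1; first by rewrite hoppK => /esym.
  rewrite -{1}(hoppK z); apply/hadd_reversible; rewrite !hoppK.
  rewrite -{2}(hoppK y).
  have /haddxN_opp/haddxN_absorb : (y ⊞ ⊟ y) z.
    by apply: hadd_solvel; rewrite -{2}wy.
  by rewrite hoppK.
have := hadd_solver yxz; rewrite yzE => xE.
by case: xNNy; rewrite xE hoppK.
Qed.

Lemma haddNxC y : ⊟ y ⊞ y = y ⊞ ⊟ y.
Proof.
apply/seteqP; split; last exact: haddxN_subNx.
by have := @haddxN_subNx (⊟ y); rewrite hoppK.
Qed.

(* For nonzero [y] in a wedge sum this is the union of [0] and of the components
   strictly below that of [y]: excluding [y] and [⊟ y] leaves the components of
   Krasner and sign type out of their own down-sets. *)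
Definition below y : set H := [set x | [/\ (y ⊞ ⊟ y) x, x <> y & x <> ⊟ y]].

Lemma below_irr x : ~ below x x.
Proof. by case. Qed.

Lemma below_oppr x y : below y x -> below y (⊟ x).
Proof.
move=> [yNx xy xNy]; split; first exact: haddxN_opp.
  by move=> xE; apply: xNy; rewrite -xE hoppK.
by move=> /(inv_inj (@hoppK H)).
Qed.

Lemma below_opp y : below (⊟ y) = below y.
Proof.
suff sub z : below (⊟ z) `<=` below z.
  by apply/seteqP; split => //; rewrite -{1}(hoppK y).
move=> x [NyNx xNy xy]; rewrite hoppK in xy NyNx.
by split => //; have := @haddxN_subNx (⊟ z); rewrite !hoppK; apply.
Qed.

Lemma belowDl x y : below y x -> x ⊞ y = [set y].
Proof.
move=> [/haddxN_absorb xyy xy xNy]; apply: hadd_set1 => //.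
by move=> xE; apply: xNy; rewrite -xE hoppK.
Qed.

Lemma belowDr x y : below y x -> y ⊞ x = [set y].
Proof.
move=> [/haddxN_subNx /hadd_solver yxy xy xNy]; rewrite hoppK in yxy.
by apply: hadd_set1 => // /esym.
Qed.

(** Mutual absorption would make [x ⊞ y] both [{x}] and [{y}]. *)
Lemma below_asym x y : below y x -> ~ below x y.
Proof.
move=> xy yx; have : [set x] y by rewrite -(belowDr yx) belowDl.
by move=> xE; apply: (@below_irr x); rewrite -{2}xE.
Qed.

Lemma below_trans y x z : below y x -> below z y -> below z x.
Proof.
move=> xy yz; have xzz : (x ⊞ z) z.
  have [|s] := (hadd_exA x y z z).2; first by exists y; rewrite belowDl.
  by rewrite belowDl // => ->.
split; first exact: hadd_solvel.
  by move=> xE; apply: (below_asym xy); rewrite xE.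
by move=> xE; apply: (below_asym xy); rewrite xE below_opp.
Qed.

(** Unless [z] is below [y] or equal to [y] or [⊟ y], the sum [z ⊞ y] is a single [w], which absorbs
    [x] because [y] does. Then [z = w ⊞ ⊟ y] absorbs [x] on the left as well. *)
Lemma below_cotrans z x y : below y x -> below z x \/ below y z.
Proof.
move=> xy; have [|yz] := pselect (below y z); [by right | left].
have [zy|zy] := pselect (z = y); first by rewrite zy.
have [zNy|zNy] := pselect (z = ⊟ y); first by rewrite zNy below_opp.
have Nzy : ⊟ z <> y by move=> zE; apply: zNy; rewrite -zE hoppK.
have [w zyw] := hadd_nonempty z y.
have wy : w <> y.
  by move=> wE; rewrite wE in zyw; apply: yz; split => //; exact: hadd_solvel.
have wxE : w ⊞ x = [set w].
  apply/seteqP; split=> [t wxt|_ ->].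
    have [|s] := (hadd_exA z y x t).2; first by exists w.
    by rewrite belowDr // => ->; rewrite (hadd_set1 Nzy zyw).
  have [|s] := (hadd_exA z y x w).1; first by exists y => //; rewrite belowDr.
  by rewrite (hadd_set1 Nzy zyw) => ->.
have Nxw : ⊟ x <> w.
  move=> xE; have : [set w] 0 by rewrite -wxE -xE; apply: haddNx.
  by move=> /= w0; apply/Nzy/hadd_eq0r; rewrite w0.
(* Absorption moves from the right of [w] to its left through [haddNxC]. *)
have xwE : x ⊞ w = [set w].
  apply/(hadd_set1 Nxw)/haddxN_absorb; rewrite -haddNxC.
  by apply: hadd_solver; rewrite wxE.
have zE : w ⊞ ⊟ y = [set z].
  by apply: hadd_set1; [move=> /(inv_inj (@hoppK H)) | exact: hadd_solvel].
have [|s] := (hadd_exA x w (⊟ y) z).2; first by exists w; rewrite ?xwE ?zE.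
rewrite zE => -> xzz; split; first exact: hadd_solvel.
  by move=> xE; rewrite -xE in yz.
by move=> xE; apply: yz; rewrite -(hoppK z) -xE; apply: below_oppr.
Qed.

(** Consequently incomparable elements have equal down-sets, and a level can be identified with its
    down-set. *)
Lemma below_sub x y : ~ below x y -> below x `<=` below y.
Proof. by move=> xy z /(below_cotrans y)[]. Qed.

Lemma below_proper x y : below x `<` below y -> below y x.
Proof. by move=> [_ yx]; apply: contrapT => /below_sub. Qed.

(** If [x] were below [w], then [⊟ x ⊞ w = {w}] would give [y = w]; if [w] were below [x], then
    [w ⊞ ⊟ y = {⊟ y}] would give [x = ⊟ y]. *)
Lemma below_add x y w :
  below x = below y -> ⊟ x <> y -> (x ⊞ y) w -> below w = below x.
Proof.
move=> xy Nxy xyw; apply/seteqP; split; apply: below_sub; [move=> wx | move=> xw].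
  have := hadd_solver xyw; rewrite belowDl; last exact: below_oppr.
  by move=> yw; apply: (@below_irr x); rewrite {1}xy yw.
have := hadd_solvel xyw; rewrite belowDl; last by rewrite below_opp -xy.
by move=> xE; apply: Nxy; rewrite xE hoppK.
Qed.

(** * The hypergroup formed by one level together with [0] *)

Section Fiber.
Variable D : set H.

(** [0] is adjoined separately: its own down-set is empty, whereas that of any nonzero element
    contains [0]. *)
Definition in_fiber : set H := [set x | x = 0 \/ below x = D].

Lemma in_fiber_opp x : in_fiber x -> in_fiber (⊟ x).
Proof. by case=> [->|xD]; [left; apply: hopp0 | right; rewrite below_opp]. Qed.

Lemma in_fiber_add x y w :
  in_fiber x -> in_fiber y -> ⊟ x <> y -> (x ⊞ y) w -> in_fiber w.
Proof.
move=> [->|xD]; first by rewrite hadd0l => yD _ ->.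
move=> [->|yD]; first by rewrite hadd0r => _ ->; right.
by move=> xy xyw; right; rewrite (@below_add x y) // xD.
Qed.

(** Sums of non-opposites stay by [below_add]. An element of [x ⊞ ⊟ x] outside the fiber differs
    from [x] and [⊟ x], hence is below [x]. *)
Lemma in_fiber_addN x y w :
  in_fiber x -> in_fiber y -> (x ⊞ y) w -> in_fiber w \/ ⊟ x = y /\ D w.
Proof.
move=> xD yD xyw; have [xy|xy] := pselect (⊟ x = y); last first.
  by left; apply: in_fiber_add xyw.
have [wD|wD] := pselect (in_fiber w); [by left | right; split=> //].
case: (xD) => [x0|<-].
  by case: wD; left; move: xyw; rewrite -xy x0 hadd0l hopp0.
split; first by rewrite xy.
  by move=> wx; apply: wD; rewrite wx.
by move=> wx; apply: wD; rewrite wx; apply: in_fiber_opp.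
Qed.

Lemma in_fiber_hadd_nonempty x y :
  in_fiber x -> in_fiber y -> exists2 w, in_fiber w & (x ⊞ y) w.
Proof.
move=> xD yD; have [<-|xy] := pselect (⊟ x = y).
  by exists 0; [left | apply: haddxN].
have [w xyw] := hadd_nonempty x y.
by exists w => //; apply: in_fiber_add xyw.
Qed.

Definition fiber_sort := {x : H | in_fiber x}.

Lemma fiber_inj (a b : fiber_sort) : sval a = sval b -> a = b.
Proof.
by case: a b => [a aD] [b bD] /= ab; subst b; rewrite (Prop_irrelevance aD bD).
Qed.

Definition fiber_zero : fiber_sort := exist _ 0 (or_introl erefl).

(** The elements of the sum that this truncation drops are those that [wedge_below] restores. *)
Definition fiber_hadd (a b : fiber_sort) : set fiber_sort :=
  [set c | (sval a ⊞ sval b) (sval c)].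

Lemma fiber_hadd_nonempty a b : fiber_hadd a b !=set0.
Proof.
have [w wD abw] := in_fiber_hadd_nonempty (svalP a) (svalP b).
by exists (exist _ w wD).
Qed.

Definition fiber_struct : hyperStructure :=
  @HyperStructure fiber_sort fiber_zero fiber_hadd fiber_hadd_nonempty.

Definition fiber_opp (a : fiber_struct) : fiber_struct :=
  exist _ (⊟ sval a) (in_fiber_opp (svalP a)).

(* An intermediate sum may leave the fiber, but only downwards and only when
   it contains [0]; being absorbed by the third summand, it can then be
   replaced by [0]. *)
Lemma fiber_haddA (a b c : fiber_struct) :
  haddS [set a] (b ⊞ c) = haddS (a ⊞ b) [set c].
Proof.
apply/seteqP; split => t /=.
  move=> [_ -> [s /= bcs ast]].
  have [|u abu uct] := (hadd_exA (sval a) (sval b) (sval c) (sval t)).1.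
    by exists (sval s).
  have [uD|[ab uD]] := in_fiber_addN (svalP a) (svalP b) abu.
    by exists (exist _ u uD) => //; exists c.
  have [c0|cD] := svalP c.
    have ut : u = sval t by move: uct; rewrite c0 hadd0r => ->.
    exists t; first by rewrite /= /fiber_hadd /= -ut.
    by exists c => //=; rewrite /fiber_hadd /= c0 hadd0r.
  exists fiber_zero; first by rewrite /= /fiber_hadd /= -ab; apply: haddxN.
  exists c => //=; rewrite /fiber_hadd /= hadd0l.
  by move: uct; rewrite belowDl ?cD.
move=> [s /= abs [_ -> sct]].
have [|u bcu aut] := (hadd_exA (sval a) (sval b) (sval c) (sval t)).2.
  by exists (sval s).
exists a => //.
have [uD|[bc uD]] := in_fiber_addN (svalP b) (svalP c) bcu.
  by exists (exist _ u uD).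
have [a0|aD] := svalP a.
  have ut : u = sval t by move: aut; rewrite a0 hadd0l => ->.
  by exists t => /=; rewrite /fiber_hadd /= -?ut // a0 hadd0l.
exists fiber_zero => /=; first by rewrite /fiber_hadd /= -bc; apply: haddxN.
rewrite /fiber_hadd /= hadd0r.
by move: aut; rewrite belowDr ?aD.
Qed.

Lemma fiber_hadd0l (a : fiber_struct) : 0 ⊞ a = [set a].
Proof.
apply/seteqP; split => b /=; rewrite /fiber_hadd /= hadd0l.
  exact: fiber_inj.
by move=> ->.
Qed.

Lemma fiber_hadd0r (a : fiber_struct) : a ⊞ 0 = [set a].
Proof.
apply/seteqP; split => b /=; rewrite /fiber_hadd /= hadd0r.
  exact: fiber_inj.
by move=> ->.
Qed.

Lemma fiber_oppr_unique (a : fiber_struct) :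
  unique [set b | (a ⊞ b) 0] (fiber_opp a).
Proof. by split=> [|b /hadd_eq0r ab]; [apply: haddxN | apply: fiber_inj]. Qed.

Lemma fiber_oppl_unique (a : fiber_struct) :
  unique [set b | (b ⊞ a) 0] (fiber_opp a).
Proof. by split=> [|b /hadd_eq0l ba]; [apply: haddNx | apply: fiber_inj]. Qed.

Lemma fiber_reversible (a b c : fiber_struct) :
  (b ⊞ c) a <-> (fiber_opp c ⊞ fiber_opp b) (fiber_opp a).
Proof. exact: hadd_reversible. Qed.

Definition fiber : hypergroup := Hypergroup fiber_haddA fiber_hadd0l
  fiber_hadd0r fiber_oppr_unique fiber_oppl_unique fiber_reversible.

Lemma fiber_stringent : stringent fiber.
Proof.
move=> a b ab; have [c abc] := fiber_hadd_nonempty a b.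
exists c; apply/seteqP; split=> [d abd|_ -> //].
apply: fiber_inj; move: abd abc.
rewrite /= /fiber_hadd /= => abd.
rewrite (hadd_set1 _ abd) // => Nab.
by apply: ab; apply: fiber_inj; rewrite /= -Nab hoppK.
Qed.

End Fiber.

(** For any other [y] of this level, let [w] be the sum [y ⊞ x]. Since [x ∈ x ⊞ x], also
    [w ∈ w ⊞ x], so [x] would be below [w], which has the same level. The exceptions fail too:
    [w = x] puts [y] below [x], and [w = ⊟ x] forces [y = ⊟ x]. *)
Lemma absorbing_level x y : x <> 0 -> (x ⊞ ⊟ x) x -> below y = below x ->
  y = x \/ y = ⊟ x.
Proof.
move=> x0 /haddxN_absorb xxx yx.
have [->|yNx] := pselect (y = ⊟ x); [by right | left].
have [->//|yx'] := pselect (y = x).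
have Nyx : ⊟ y <> x by move=> yE; apply: yNx; rewrite -yE hoppK.
have [w yxw] := hadd_nonempty y x.
have yxE := hadd_set1 Nyx yxw.
have wx : below w = below x by rewrite (below_add yx Nyx yxw).
have wxw : (w ⊞ x) w.
  have [|s] := (hadd_exA y x x w).1; first by exists x.
  by rewrite yxE => ->.
have [wE|wNx] := pselect (w = x).
  case: (@below_irr y); rewrite {1}yx; split=> //.
  by rewrite wE in yxw; apply: hadd_solvel.
have [wE|wNNx] := pselect (w = ⊟ x).
  have := hadd_solvel yxw; rewrite wE (@hadd_set1 _ _ (⊟ x)) //.
    by move=> xx; apply: wNx; rewrite wE -xx hoppK.
  exact: (hadd_reversible x x x).1.
case: (@below_irr x); rewrite -{1}wx; split.
- by rewrite -haddNxC; apply: hadd_solver.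
- exact/nesym.
- by move=> xE; apply: wNNx; rewrite xE hoppK.
Qed.

End Stringent.

(** * Isomorphisms with the Krasner and sign hypergroups, given by explicit maps out of these
    models *)

Lemma hiso_of_inverse (G H : hyperStructure) (f : H -> G) :
    injective f -> (forall y, exists x, f x = y) -> f 0 = 0 ->
    (forall x y, f @` (x ⊞ y) = f x ⊞ f y) ->
  hiso G H.
Proof.
move=> f_inj f_surj f0 fD; pose g y := sval (cid (f_surj y)).
have gK : cancel g f by move=> y; apply: svalP (cid (f_surj y)).
have fK : cancel f g by move=> x; apply: f_inj; rewrite gK.
exists g; split; [by exists f | by rewrite -f0 fK | move=> x y].
rewrite -{1}(gK x) -{1}(gK y) -fD image_comp.
by under eq_imagel do rewrite /= fK; rewrite image_id.
Qed.

Lemma hiso_krasner (F : hypergroup) (x : F) : x <> 0 -> (x ⊞ x) 0 ->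
  (x ⊞ x) x -> (forall y, y = 0 \/ y = x) -> hiso F krasner.
Proof.
move=> x0 xx0 xxx Fx; pose f (b : krasner) : F := if b then x else 0.
apply: (@hiso_of_inverse _ _ f) => //.
- by case=> [] [] // /esym.
- by move=> y; have [->|->] := Fx y; [exists false | exists true].
- case=> [] [] /=; rewrite /krasner_add /= ?hadd0l ?hadd0r ?image_set1 //.
  apply/seteqP; split=> [_ [[] _ <-] //|y _].
  by have [->|->] := Fx y; [exists false | exists true].
Qed.

Lemma hiso_sign (F : hypergroup) (x : F) : stringent F -> x <> 0 ->
  ⊟ x <> x -> (x ⊞ x) x -> (forall y, [\/ y = 0, y = x | y = ⊟ x]) ->
  hiso F sign_hypergroup.
Proof.
move=> Fs x0 xN xxx Fx.
pose f (s : sign_hypergroup) : F :=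
  match s with Zero => 0 | Plus => x | Minus => ⊟ x end.
have Nx0 : ⊟ x <> 0 by move=> Nx0; apply: x0; rewrite -(hoppK x) Nx0 hopp0.
have xxE : x ⊞ x = [set x] by apply: hadd_set1.
have NxNxE : ⊟ x ⊞ ⊟ x = [set ⊟ x].
  apply: hadd_set1 => //; first by rewrite hoppK => /esym.
  by apply/hadd_reversible; rewrite !hoppK.
have f_surj y : exists s, f s = y.
  by have [->|->|->] := Fx y; [exists Zero | exists Plus | exists Minus].
have xNxx : (x ⊞ ⊟ x) x by apply: hadd_solvel.
have imT : f @` setT = x ⊞ ⊟ x.
  apply/seteqP; split=> [_ [[] _ <-] /=|y _]; first exact: haddxN.
  - done.
  - exact: haddxN_opp.
  - by have [s <-] := f_surj y; exists s.
apply: (@hiso_of_inverse _ _ f) => //.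
- by case=> [] [] //= /esym.
- case=> [] [] /=; rewrite /sign_add /= ?hadd0l ?hadd0r ?image_set1 //.
  (* The remaining case [Minus], [Plus], where the sum is [⊟ x ⊞ x]. *)
  by rewrite (haddNxC Fs).
Qed.

(** * Single-valued hypergroups are groups *)

Section SingleValued.
Variable F : hypergroup.
Hypothesis F_single : forall x y : F, exists z, x ⊞ y = [set z].

(** An alias of [F] recording the proof, so that a group instance can be attached to it. *)
Definition single_valued of (forall x y : F, exists z, x ⊞ y = [set z]) : Type :=
  F.
Local Notation K := (single_valued F_single).

Definition single_mul (x y : K) : K := sval (cid (F_single x y)).

Lemma single_mulE (x y : K) : (x : F) ⊞ y = [set single_mul x y].
Proof. exact: svalP (cid (F_single x y)). Qed.

Lemma single_mulP (x y z : K) : ((x : F) ⊞ y) z -> single_mul x y = z.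
Proof. by rewrite single_mulE => ->. Qed.

Lemma single_mulA : associative single_mul.
Proof.
move=> x y z; apply: single_mulP.
have [|s] := (@hadd_exA F x y z (single_mul (single_mul x y) z)).2.
  by exists (single_mul x y); rewrite single_mulE.
by rewrite (single_mulE y z) => ->.
Qed.

Lemma single_mul1 : left_id (0 : F) single_mul.
Proof. by move=> x; apply: single_mulP; rewrite hadd0l. Qed.

Lemma single_mulr1 : right_id (0 : F) single_mul.
Proof. by move=> x; apply: single_mulP; rewrite hadd0r. Qed.

Lemma single_mulV : left_inverse (0 : F) (@hopp F) single_mul.
Proof. by move=> x; apply: single_mulP; apply: haddNx. Qed.

Lemma single_mulrV : right_inverse (0 : F) (@hopp F) single_mul.
Proof. by move=> x; apply: single_mulP; apply: haddxN. Qed.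

HB.instance Definition _ := gen_eqMixin K.
HB.instance Definition _ := gen_choiceMixin K.
HB.instance Definition _ := isGroup.Build K single_mulA single_mul1
  single_mulr1 single_mulV single_mulrV.

Lemma hiso_group : exists K : groupType, hiso F (group_hyper K).
Proof.
exists K, id; split=> [||x y] //; first exact: (Bijective (g := id)).
by rewrite image_id; apply: single_mulE.
Qed.

End SingleValued.

(** * Classification of the fibers and the total order on levels *)

Section Levels.
Variables (H : hypergroup) (H_stringent : stringent H).

Lemma fiber_neq0 D (a : fiber H_stringent D) : a <> 0 <-> sval a <> 0.
Proof.
split=> a0; last by move=> aE; apply: a0; rewrite aE.
by move=> aE; apply: a0; apply: fiber_inj.
Qed.

Lemma fiber_level D (a : fiber H_stringent D) : a <> 0 -> below (sval a) = D.
Proof. by move=> /fiber_neq0; have [|//] := svalP a. Qed.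

Lemma fiber_classification D : let F := fiber H_stringent D in
  [\/ hiso F krasner, hiso F sign_hypergroup |
      exists K : groupType, hiso F (group_hyper K)].
Proof.
move=> F.
have [[a [a0 aa]]|noabs] := pselect (exists a : F, a <> 0 /\ (a ⊞ ⊟ a) a).
  have Fa (y : F) : [\/ y = 0, y = a | y = ⊟ a].
    have [->|y0] := pselect (y = 0); first by apply: Or31.
    have [||ya|ya] := @absorbing_level _ H_stringent (sval a) (sval y) _ aa.
    - exact/fiber_neq0.
    - by rewrite !fiber_level.
    - exact/Or32/fiber_inj.
    - exact/Or33/fiber_inj.
  have aaa := haddxN_absorb aa.
  have [Na|Na] := pselect (⊟ a = a).
    apply/Or31/(hiso_krasner a0) => //; first by rewrite -{2}Na; apply: haddxN.
    by move=> y; have [->|->|->] := Fa y; [left | right | right].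
  exact/Or32/(hiso_sign (@fiber_stringent _ H_stringent D) a0).
apply/Or33/hiso_group => x y.
have [<-|xy] := pselect (⊟ x = y); last first.
  have [z xyz] := hadd_nonempty x y.
  by exists z; apply: hadd_set1 xyz => //; apply: fiber_stringent.
(* A nonzero [z ∈ x ⊞ ⊟ x] has the level of [x], so it would be below itself unless it is [x] or
   [⊟ x]; either of these puts [x] in [x ⊞ ⊟ x]. *)
exists 0; apply/seteqP; split=> [z xz|_ ->]; last exact: haddxN.
apply: contrapT => z0.
have x0 : x <> 0 by move=> x0; move: xz; rewrite x0 hadd0l hopp0.
have xzE : below (sval x) = below (sval z) by rewrite !fiber_level.
apply: (@below_irr _ (sval z)); rewrite -{1}xzE.
split=> // [/fiber_inj zx|zx].
  by apply: noabs; exists x; split=> //; rewrite -{3}zx.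
apply: noabs; exists x; split=> //; move: xz => /haddxN_opp.
by rewrite (_ : z = ⊟ x) ?hoppK //; apply: fiber_inj.
Qed.

(* A component is represented by the common down-set of its nonzero elements,
   so that the order of the components is inclusion. *)
Definition level_of of stringent H : Type :=
  {D : set H | `[< exists2 x, x <> 0 & D = below x >]}.
Local Notation level := (level_of H_stringent).

HB.instance Definition _ := SubType.on level.
HB.instance Definition _ := [Choice of level by <:].
HB.instance Definition _ :=
  [SubChoice_isSubPOrder of level by <: with Order.Disp tt tt].

Lemma levelP (g : level) : exists2 x, x <> 0 & val g = below x.
Proof. by case: g => A /= /asboolP. Qed.

(** When [x] is below [y], the inclusion is strict because [x] itself lies in [below y] but not in
    [below x]. *)
Lemma level_ltP (g h : level) x y :
  val g = below x -> val h = below y -> (g < h)%O <-> below y x.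
Proof.
move=> gx hy; rewrite -lt_val gx hy properEset.
split=> [/(below_proper H_stringent)//|xy]; split=> [z zx|yx].
  exact: below_trans zx xy.
by apply: (@below_irr _ x); apply: yx.
Qed.

Lemma level_total : total (<=%O : rel level).
Proof.
move=> g h; have [x _ gx] := levelP g; have [y _ hy] := levelP h.
rewrite -!Order.le_val gx hy; apply/orP.
have [xy|xy] := pselect (below y x); [left | right]; apply/subsetPset.
  by move=> z zx; exact: below_trans zx xy.
exact: below_sub.
Qed.

HB.instance Definition _ := Order.POrder_isTotal.Build _ level level_total.

Definition level_of_elt (x : H) (x0 : x <> 0) : level :=
  exist _ (below x) (asboolT (ex_intro2 _ _ x x0 erefl)).

Let F (g : level) := fiber H_stringent (val g).

(** * The comparison map from the wedge sum to [H] *)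

Definition of_wedge (u : wedge F) : H :=
  if u is Some v then sval (sval (tagged v)) else 0.

Lemma of_wedge_wedge_in (g : level) (a : F g) : of_wedge (wedge_in a) = sval a.
Proof. by rewrite /wedge_in; case: pselect => [->|]. Qed.

Lemma of_wedge_neq0 (v : wedge_nonzero F) : of_wedge (Some v) <> 0.
Proof. by have /fiber_neq0 := svalP (tagged v). Qed.

Lemma of_wedge_level (v : wedge_nonzero F) : below (of_wedge (Some v)) = val (psi v).
Proof. exact: fiber_level (svalP (tagged v)). Qed.

Lemma of_wedge_inj : injective of_wedge.
Proof.
move=> [v|] [w|] // vw; last 2 first.
- by have := @of_wedge_neq0 v.
- by have := @of_wedge_neq0 w; rewrite -vw.
have /val_inj : val (psi v) = val (psi w) by rewrite -!of_wedge_level vw.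
case: v w vw => [g [a a0]] [h [b b0]] /= ab gh; subst h.
have {}ab : a = b by apply: fiber_inj.
by subst b; rewrite (Prop_irrelevance a0 b0).
Qed.

Lemma of_wedge_surj x : exists u, of_wedge u = x.
Proof.
have [->|x0] := pselect (x = 0); first by exists None.
exists (wedge_in (exist _ x (or_intror erefl) : F (level_of_elt x0))).
exact: of_wedge_wedge_in.
Qed.

Lemma psi_ltP (v w : wedge_nonzero F) :
  (psi v < psi w)%O <-> below (of_wedge (Some w)) (of_wedge (Some v)).
Proof. exact: level_ltP (esym (of_wedge_level v)) (esym (of_wedge_level w)). Qed.

(** [below] contains [0] but [wedge_below] does not; in a wedge sum of opposites [0] comes from the
    fiber. *)
Lemma of_wedge_belowP (v : wedge_nonzero F) x :
  (of_wedge @` wedge_below (psi v)) x <-> x <> 0 /\ below (of_wedge (Some v)) x.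
Proof.
split=> [[_ [w wv <-] <-]|[x0 xv]].
  by split; [exact: of_wedge_neq0 | exact/psi_ltP].
have [[w|] wE] := of_wedge_surj x; last by case: x0.
by exists (Some w) => //; exists w => //; apply/psi_ltP; rewrite wE.
Qed.

Lemma of_wedge_fiber_image (g : level) (A : set (F g)) :
  of_wedge @` (@wedge_in _ _ F g @` A) = sval @` A.
Proof. by rewrite image_comp; apply: eq_imagel => a _; apply: of_wedge_wedge_in. Qed.

Lemma of_wedge_hadd u v : of_wedge @` (u ⊞ v) = of_wedge u ⊞ of_wedge v.
Proof.
case: u v => [u|] [v|]; last 3 first.
- by rewrite hadd0r /= image_set1.
- by rewrite hadd0l /= image_set1.
- by rewrite /= hadd0l image_set1.
rewrite [_ ⊞ _ in LHS]/=.
have [vu|uv|uv] := ltgtP (psi v) (psi u).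
- by rewrite image_set1 belowDr //; apply/psi_ltP.
- by rewrite image_set1 belowDl //; apply/psi_ltP.
(* At equal levels, identifying the tags turns the cast in [fiber_add] into the identity. *)
case: u v uv => [g [a a0]] [h [b b0]] /= hg; subst h.
rewrite /fiber_add tagged_asE /=.
set B := wedge_below _.
transitivity ((fun c : F g => sval c) @` (a ⊞ b) `|`
   (if `[< (a ⊞ b) 0 >] then of_wedge @` B else set0)).
  case: ifP => _; rewrite ?image_setU of_wedge_fiber_image ?setU0 //.
have BP x : (of_wedge @` B) x <-> x <> 0 /\ below (sval a) x.
  exact: (of_wedge_belowP (Tagged (nonzero F) (exist _ a a0 : nonzero F g))).
apply/seteqP; split=> [x [[c abc <-] //|]|x abx].
  case: ifP => // /asboolP/hadd_eq0r <- /BP[_].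
  by case.
have [xg|xg] := pselect (in_fiber (val g) x).
  by left; exists (exist _ x xg).
(* Only opposite summands produce elements outside the fiber, and exactly their fiber sum contains
   [0], which selects the branch with [wedge_below]. *)
have [//|[ab gx]] := in_fiber_addN H_stringent (svalP a) (svalP b) abx.
right; rewrite ifT; last first.
  by apply/asboolP; rewrite /= /fiber_hadd /= -ab; apply: haddxN.
apply/BP; rewrite fiber_level //; split=> // x0.
by apply: xg; left.
Qed.

End Levels.

Theorem theorem1p6 (H : hypergroup) (H_stringent : stringent H) :
  exists (d : Order.disp_t) (G : orderType d) (F : G -> hypergroup),
    [/\ forall g : G, exists x : wedge_nonzero F, psi x = g,
        forall g : G,
          [\/ hiso (F g) krasner,
              hiso (F g) sign_hypergroup |
              exists K : groupType, hiso (F g) (group_hyper K)] &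
        hiso H (wedge F)].
Proof.
exists _, (level_of H_stringent : orderType _),
  (fun g => fiber H_stringent (val g)).
split=> [g|g|].
- have [x x0 gx] := levelP g; have [[v|] vx] := of_wedge_surj H_stringent x.
    by exists v; apply: val_inj; rewrite -of_wedge_level vx gx.
  by case: x0.
- exact: fiber_classification.
- apply: (@hiso_of_inverse _ _ (@of_wedge _ H_stringent)) => //.
  + exact: of_wedge_inj.
  + exact: of_wedge_surj.
  + exact: of_wedge_hadd.
Qed.
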